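(* If $\mathcal D$ is a strongly connected Markov Trace Model, then $\mathcal D$ has a unique stationary distribution.
   Context: Fix a set of points (a metric space) $X$. A trace is a finite sequence $T=(T(0),\dots,T(|T|-1))$ of at least two points of $X$ (not necessarily distinct); $|T|$ is the number of its points, $T_{start}=T(0)$, $T_{end}=T(|T|-1)$. For a (possibly infinite) set of traces $\mathcal T$: $\mathcal T^{\mathrm{out}}(u)=\{T\in\mathcal T: T_{start}=u\}$, $\mathcal T(u,v)=\{T\in\mathcal T: T_{start}=u,\ T_{end}=v\}$, $P(\mathcal T)=\{u\in X:\mathcal T^{\mathrm{out}}(u)\ne\emptyset\}$, $S(\mathcal T)=\{\langle T,i\rangle: T\in\mathcal T,\ 1\le i\le |T|-1\}$. $\mathcal T$ is endless if for every $T\in\mathcal T$ there is $T'\in\mathcal T$ with $T'_{start}=T_{end}$. A Markov Trace Model (MTM) is a pair $\mathcal D=(\mathcal T,\Psi)$ where $\mathcal T$ is an endless set of traces with $|P(\mathcal T)|<\infty$ and $\Psi=\{\psi_u\}_{u\in P(\mathcal T)}$ is a family with $\psi_u$ a probability distribution over $\mathcal T^{\mathrm{out}}(u)$ for each $u$. It determines a Markov chain $\mathcal M_{\mathcal D}$ with state space $S(\mathcal T)$ and transition probabilities: $\Pr(\langle T,i\rangle\to\langle T,i+1\rangle)=1$ for $1\le i<|T|-1$; $\Pr(\langle T,|T|-1\rangle\to\langle T',1\rangle)=\psi_{T_{end}}(T')$ for $T'\in\mathcal T^{\mathrm{out}}(T_{end})$; all other transition probabilities are $0$. A stationary distribution of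 $\mathcal D$ is a stationary probability distribution of $\mathcal M_{\mathcal D}$. For distinct $u,v\in P(\mathcal T)$, $u$ is connected to $v$ in $\mathcal D$ if there is a sequence $(z_0,\dots,z_k)$ of points of $P(\mathcal T)$ with $z_0=u$, $z_k=v$ and $\sum_{T\in\mathcal T(z_i,z_{i+1})}\psi_{z_i}(T)>0$ for all $i=0,\dots,k-1$. $\mathcal D$ is strongly connected if $u$ is connected to $v$ for every pair of (distinct) $u,v\in P(\mathcal T)$.
   Formalization: The trace set is assumed nonempty and, for each u in P(T), the mean number of points of a trace drawn from ψ_u is assumed finite; without these a strongly connected model has no stationary distribution. *)

(* Defs.v *)
From HB Require Import structures.
From mathcomp Require Import all_boot all_order all_algebra.
From mathcomp Require Import all_classical all_reals.
From mathcomp Require Import ereal sequences esum.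

Set Implicit Arguments.
Unset Strict Implicit.
Unset Printing Implicit Defensive.

Import Order.TTheory GRing.Theory Num.Theory.

Local Open Scope classical_set_scope.
Local Open Scope ring_scope.

(* The trace (T(0), ..., T(n)) is encoded as the pair (T(0), [:: T(1); ...; T(n)]);
   the second component is nonempty, so a trace has at least two points. *)
Definition trace (X : Type) := {T : X * seq X | (0 < size T.2)%N}.

Section Trace.
Variable X : Type.
Implicit Type T : trace X.

Definition points T : seq X := (val T).1 :: (val T).2.

Definition tlen T : nat := size (points T).

Definition tstart T : X := (val T).1.

Definition tend T : X := last (val T).1 (val T).2.

End Trace.

Section TraceSets.
Variables (X : choiceType) (A : set (trace X)).

Definition out (u : X) : set (trace X) := [set T | A T /\ tstart T = u].

Definition between (u v : X) : set (trace X) :=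
  [set T | [/\ A T, tstart T = u & tend T = v]].

Definition starts : set X := [set u | out u !=set0].

Definition states : set (trace X * nat) :=
  [set s | A s.1 /\ (1 <= s.2 <= (tlen s.1).-1)%N].

Definition endless : Prop :=
  forall T, A T -> exists2 T', A T' & tstart T' = tend T.

End TraceSets.

(* Distributions are discrete, and are represented by mass functions on the
   ambient type that vanish off their carrier S, so that two distributions on S
   are the same exactly when they are equal as functions. *)
Definition distribution_on (R : realType) (T : choiceType) (S : set T)
    (p : T -> R) : Prop :=
  [/\ forall x, S x -> 0 <= p x,
      forall x, ~ S x -> p x = 0 &
      (\esum_(x in S) (p x)%:E = 1)%E].

(* psi u is constrained only for u in starts traces; its other values are
   irrelevant. *)
Record mtm (R : realType) (X : choiceType) := MTM {
  traces : set (trace X);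
  psi : X -> trace X -> R;
  traces_endless : endless traces;
  starts_finite : finite_set (starts traces);
  psi_distribution :
    forall u, starts traces u -> distribution_on (out traces u) (psi u)
}.

(* In the second branch, for a state s one has s.2 = (tlen s.1).-1. *)
Definition transition (R : realType) (X : choiceType) (D : mtm R X)
    (s t : trace X * nat) : R :=
  if (s.2 < (tlen s.1).-1)%N then (t == (s.1, s.2.+1))%:R
  else if `[< out (traces D) (tend s.1) t.1 >] && (t.2 == 1)%N
       then psi D (tend s.1) t.1
       else 0.

Definition stationary_for (R : realType) (S : choiceType) (A : set S)
    (P : S -> S -> R) (p : S -> R) : Prop :=
  distribution_on A p /\
  forall t, A t -> (\esum_(s in A) (p s * P s t)%:E = (p t)%:E)%E.

Definition stationary (R : realType) (X : choiceType) (D : mtm R X)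
    (p : trace X * nat -> R) : Prop :=
  stationary_for (states (traces D)) (transition D) p.

Definition connected_to (R : realType) (X : choiceType) (D : mtm R X)
    (u v : X) : Prop :=
  exists (k : nat) (z : nat -> X),
    [/\ z 0%N = u, z k = v,
        forall i, (i <= k)%N -> starts (traces D) (z i) &
        forall i, (i < k)%N ->
          (0 < \esum_(T in between (traces D) (z i) (z i.+1))
                 (psi D (z i) T)%:E)%E].

Definition strongly_connected (R : realType) (X : choiceType) (D : mtm R X) :
    Prop :=
  forall u v, starts (traces D) u -> starts (traces D) v -> u <> v ->
    connected_to D u v.

(* A trace set can contain arbitrarily long traces, so the mean number of points
   of a trace drawn from psi u may be infinite. If it is for some u, a strongly
   connected model is null recurrent and has no stationary distribution. *)
Definition finite_mean_length (R : realType) (X : choiceType) (D : mtm R X) :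
    Prop :=
  forall u, starts (traces D) u ->
    (\esum_(T in out (traces D) u) (psi D u T * (tlen T)%:R)%:E < +oo)%E.

(* Main.v *)
(* Along a trace the flow into <T, i+1> comes only from <T, i>, so a stationary
   p is constant on each trace, and the flow into <T, 1> gives
   p(T, i) = q(T_start) psi_{T_start}(T), where q(v) is the total mass of the
   last states of the traces that end at v. Thus p is stationary iff q is
   invariant for the finite stochastic matrix K(u, v) = sum of psi_u over T(u, v)
   and sum_u q(u) L(u) = 1, where L(u) >= 1 is the mean number of states of a
   trace drawn from psi_u. Strong connectedness makes K irreducible, so q exists
   and is unique: K - 1 has a nonzero left kernel vector q, |q| is invariant too,
   and an invariant vector of an irreducible K has constant sign, which rules out
   a nonzero difference r of two solutions since sum_u r(u) L(u) = 0. *)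
Require Import Defs.
From mathcomp Require Import all_boot all_order all_algebra.
From mathcomp Require Import all_classical all_reals.
From mathcomp Require Import ereal sequences esum.

Set Implicit Arguments.
Unset Strict Implicit.
Unset Printing Implicit Defensive.

Import Order.TTheory GRing.Theory Num.Theory.

Local Open Scope classical_set_scope.
Local Open Scope ring_scope.

(** * Invariant vectors of a finite stochastic matrix *)

Definition stochastic (R : realType) (X : eqType) (s : seq X)
    (K : X -> X -> R) : Prop :=
  (forall u v, u \in s -> v \in s -> 0 <= K u v) /\
  (forall u, u \in s -> \sum_(v <- s) K u v = 1).

Definition invariant_for (R : realType) (X : eqType) (s : seq X)
    (K : X -> X -> R) (q : X -> R) : Prop :=
  forall v, v \in s -> \sum_(u <- s) q u * K u v = q v.

(** Closed sets replace paths: the uniqueness proof applies this to the set of points where a vector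
    is positive. *)
Definition irreducible_chain (R : realType) (X : eqType) (s : seq X)
    (K : X -> X -> R) : Prop :=
  forall B : pred X,
    (forall u v, u \in s -> v \in s -> B u -> 0 < K u v -> B v) ->
    forall u v, u \in s -> v \in s -> B u -> B v.

(* The inequality |q v| <= \sum_u |q u| K(u, v) becomes an equality after
   summation over v, hence it is an equality for each v. *)
Lemma invariant_for_norm (R : realType) (X : eqType) (s : seq X)
    (K : X -> X -> R) (q : X -> R) :
  stochastic s K -> invariant_for s K q ->
  invariant_for s K (fun u => `|q u|).
Proof.
move=> [K0 K1] qK.
have le v : v \in s -> 0 <= \sum_(u <- s) `|q u| * K u v - `|q v|.
  move=> vs; rewrite subr_ge0 -(qK v vs) (le_trans (ler_norm_sum _ _ _))//.
  rewrite !big_seq; apply: ler_sum => u us.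
  by rewrite normrM (ger0_norm (K0 _ _ us vs)).
have sum0 : \sum_(v <- s | v \in s) (\sum_(u <- s) `|q u| * K u v - `|q v|) = 0.
  rewrite -big_seq sumrB exchange_big/= -sumrB big_seq big1// => u us.
  by rewrite -big_distrr/= K1// mulr1 subrr.
move/eqP: sum0; rewrite psumr_eq0// => /allP h v vs.
by have := h v vs; rewrite vs/= subr_eq0 => /eqP.
Qed.

Lemma invariant_for_exists (R : realType) (X : eqType) (s : seq X)
    (K : X -> X -> R) :
  uniq s -> (0 < size s)%N -> stochastic s K ->
  exists q : X -> R, [/\ forall u, 0 <= q u, invariant_for s K q &
    exists2 u, u \in s & q u != 0].
Proof.
move=> us s0 KS; have [_ K1] := KS.
pose e (i : 'I_(size s)) := tnth (in_tuple s) i.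
have es i : e i \in s by exact: mem_tnth.
have ei : injective e by apply/tuple_uniqP.
have sumE (F : X -> R) : \sum_(u <- s) F u = \sum_i F (e i).
  by rewrite (big_tnth _ _ s).
pose A := \matrix_(i, j) K (e i) (e j) - 1%:M.
have : \det A == 0.
  (* The rows of [K] sum to 1, so [A] kills the constant column; [det0P] wants a left kernel vector,
     hence the transpose. *)
  rewrite -det_tr; apply/det0P; exists (const_mx 1).
    apply/eqP => /rowP/(_ (Ordinal s0)); rewrite !mxE => /eqP.
    by rewrite oner_eq0.
  apply/rowP => i; rewrite !mxE.
  under eq_bigr do rewrite !mxE mul1r.
  rewrite sumrB -sumE K1//.
  by rewrite (bigD1 i)//= eqxx big1 ?addr0 ?subrr// => j /negPf; rewrite eq_sym => ->.
move=> /det0P[r r0 rA].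
(* This carries [r] from indices to points, with value 0 off [s]; as [e] is injective, at most one
   term occurs. *)
pose q u := \sum_(i | e i == u) r 0 i.
have qe i : q (e i) = r 0 i.
  by rewrite /q (eq_bigl (pred1 i)) ?big_pred1_eq// => j; rewrite inj_eq.
have esurj u : u \in s -> exists i, u = e i.
  by move=> /(tnthP (in_tuple s))[i ->]; exists i.
have qK : invariant_for s K q.
  move=> v /esurj[j ->]; rewrite qe sumE.
  move/rowP: rA => /(_ j); rewrite !mxE.
  under eq_bigr do rewrite !mxE mulrBr.
  rewrite sumrB => /eqP; rewrite subr_eq0 => /eqP.
  under eq_bigr do rewrite -qe; move=> ->.
  rewrite (bigD1 j)//= eqxx mulr1 big1 ?addr0// => i /negPf ->.
  by rewrite mulr0.
exists (fun u => `|q u|); split=> //; first exact: invariant_for_norm.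
move/eqP: r0; apply: contra_notP => /forall2NP h; apply/rowP => i; rewrite mxE -qe.
have [/(_ (es i))//|/negP] := h (e i).
by rewrite negbK normr_eq0 => /eqP.
Qed.

(* If r is invariant then so is r + |r| >= 0, whose support is closed; by
   irreducibility an invariant r is everywhere positive or nowhere positive. *)
Lemma invariant_for_unique (R : realType) (X : eqType) (s : seq X)
    (K : X -> X -> R) (L q1 q2 : X -> R) :
  stochastic s K -> irreducible_chain s K ->
  (forall u, u \in s -> 0 < L u) ->
  invariant_for s K q1 -> invariant_for s K q2 ->
  \sum_(u <- s) q1 u * L u = \sum_(u <- s) q2 u * L u ->
  {in s, q1 =1 q2}.
Proof.
move=> KS irr L0 q1K q2K q12.
pose r u := q1 u - q2 u.
have rK : invariant_for s K r.
  move=> v vs; rewrite /r -(q1K v)// -(q2K v)//.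
  by under eq_bigr do rewrite mulrBl; rewrite sumrB.
have rL : \sum_(u <- s) r u * L u = 0.
  by under eq_bigr do rewrite mulrBl; rewrite sumrB q12 subrr.
have aK := invariant_for_norm KS rK.
(* [|r| + r] is twice the positive part of [r], so it is nonzero exactly where [r] is positive. *)
have pos x : (0 < r x) = (0 < `|r x| + r x).
  case: (ltrgt0P (r x)) => [x0|x0|->]; last by rewrite addr0 ltxx.
    by rewrite addr_gt0.
  by rewrite addNr ltxx.
have cst u v : u \in s -> v \in s -> 0 < r u -> 0 < r v.
  apply: (irr (fun x => 0 < r x)) => {}u {}v us vs.
  rewrite !pos => u0 Kuv.
  rewrite -(aK v)// -(rK v)// -big_split/=.
  under eq_bigr do rewrite -mulrDl.
  rewrite (perm_big _ (perm_to_rem us)) big_cons/= ltr_wpDr ?mulr_gt0//.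
  rewrite big_seq; apply: sumr_ge0 => x /mem_rem xs.
  apply: mulr_ge0; last exact: KS.1.
  by rewrite -[X in _ + X]opprK subr_ge0 -normrN ler_norm.
(* If [r] is positive somewhere, it is so everywhere and its weighted sum cannot be 0; otherwise the
   [- r u * L u] are nonnegative with sum 0, so all vanish. *)
have [[u us ru]|nr] := pselect (exists2 u, u \in s & 0 < r u).
  suff : 0 < \sum_(u <- s) r u * L u by rewrite rL ltxx.
  rewrite (perm_big _ (perm_to_rem us)) big_cons/= ltr_wpDr ?mulr_gt0 ?L0//.
  rewrite big_seq; apply: sumr_ge0 => x /mem_rem xs.
  by rewrite mulr_ge0// ltW ?L0// (cst u).
have le0 u : u \in s -> 0 <= - r u * L u.
  move=> us; rewrite mulr_ge0 ?(ltW (L0 _ us))// oppr_ge0 leNgt.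
  by apply/negP => ru; apply: nr; exists u.
have /eqP : \sum_(u <- s | u \in s) - r u * L u = 0.
  rewrite -big_seq; under eq_bigr do rewrite mulNr.
  by rewrite sumrN rL oppr0.
rewrite psumr_eq0// => /allP h u us; have := h u us; rewrite us/=.
by rewrite mulf_eq0 oppr_eq0 (gt_eqF (L0 u us)) orbF subr_eq0 => /eqP.
Qed.

(** * Scaling, fibering and localising nonnegative sums *)

Lemma esumZl (R : realType) (T : choiceType) (I : set T) (c : R)
    (a : T -> \bar R) :
  0 <= c -> (forall i, I i -> (0 <= a i)%E) ->
  (\esum_(i in I) (c%:E * a i) = c%:E * \esum_(i in I) a i)%E.
Proof.
move=> c0 a0; rewrite /esum -ereal_supZl//; last first.
  by apply/set0P; exists 0%E, set0; [exact: fsets_set0|rewrite fsbig_set0].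
have cE X : fsets I X ->
    (c%:E * \sum_(i \in X) a i = \sum_(i \in X) c%:E * a i)%E.
  move=> [finX XI]; rewrite !fsbig_finite//= big_seq ge0_sume_distrr.
    by rewrite -big_seq.
  by move=> i; rewrite in_fset_set// => /set_mem/XI/a0.
congr ereal_sup; apply/seteqP; split=> [_ [X XI <-]|_ [_ [X XI <-] <-]].
  by exists (\sum_(i \in X) a i)%E; [exists X|exact: cE].
by exists X => //; rewrite cE.
Qed.

(** Exactly one entry of [s] equals [g x], so [a x] is a finite sum over [s] of indicator terms and
    the two sums can be exchanged. *)
Lemma esum_fibers (R : realType) (T X : choiceType) (I : set T)
    (g : T -> X) (s : seq X) (a : T -> \bar R) :
  uniq s -> (forall x, I x -> g x \in s) -> (forall x, I x -> (0 <= a x)%E) ->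
  (\esum_(x in I) a x =
   \sum_(u <- s) \esum_(x in I `&` [set x | g x = u]) a x)%E.
Proof.
move=> us gs a0.
transitivity (\esum_(x in I) \sum_(u <- s) if g x == u then a x else 0%E)%E.
  apply: eq_esum => x Ix; rewrite -big_mkcond/=.
  rewrite big_mkcond/= (bigD1_seq (g x))/= ?gs// eqxx big1 ?adde0// => u.
  by rewrite eq_sym => /negPf ->.
rewrite esum_sum; last by move=> x u Ix _; case: ifP => // _; exact: a0.
apply: eq_bigr => u _; rewrite esum_mkcondr.
apply: eq_esum => x _; congr (if _ then _ else _).
by apply/eqP/idP => [gx|]; [rewrite inE|rewrite inE].
Qed.

Lemma esum_only (R : realType) (T : choiceType) (I : set T) (t : T)
    (a : T -> \bar R) :
  I t -> (0 <= a t)%E -> (forall x, I x -> x <> t -> a x = 0%E) ->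
  (\esum_(x in I) a x = a t)%E.
Proof.
move=> It a0 an.
rewrite -(esum_set1 a0) [in RHS]esum_mkcond esum_mkcond.
apply: eq_esum => x _; have [->|/eqP xt] := eqVneq x t.
  by rewrite !mem_set.
rewrite [in RHS]memNset//; case: ifPn => // /set_mem Ix.
exact: an.
Qed.

(** * Sums over states and flow into a state *)

Definition steps (X : Type) (T : trace X) : nat := (tlen T).-1.

Lemma steps_gt0 (X : Type) (T : trace X) : (0 < steps T)%N.
Proof. exact: (valP T). Qed.

Lemma psi_ge0 (R : realType) (X : choiceType) (D : mtm R X) (T : trace X) :
  traces D T -> 0 <= psi D (tstart T) T.
Proof.
by move=> DT; have [|+ _ _] := @psi_distribution _ _ D (tstart T);
  [exists T|apply].
Qed.

Lemma esum_statesE (R : realType) (X : choiceType) (A : set (trace X))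
    (f : trace X * nat -> R) :
  (forall s, states A s -> 0 <= f s) ->
  (\esum_(s in states A) (f s)%:E =
   \esum_(T in A) \esum_(i in [set i | 1 <= i <= steps T]%N) (f (T, i))%:E)%E.
Proof.
move=> f0; rewrite esum_esum.
  by apply: eq_esum => -[T i].
by move=> T i AT iT; rewrite lee_fin f0.
Qed.

Lemma esum_states_trace (R : realType) (X : choiceType) (A : set (trace X))
    (m : trace X -> R) :
  (forall T, A T -> 0 <= m T) ->
  (\esum_(s in states A) (m s.1)%:E =
   \esum_(T in A) (m T * (steps T)%:R)%:E)%E.
Proof.
move=> m0; rewrite (@esum_statesE _ _ _ (fun s => m s.1)) => [|s [/m0]//].
apply: eq_esum => T AT /=.
have -> : [set i | 1 <= i <= steps T]%N = [set` iota 1 (steps T)].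
  by apply/seteqP; split=> i /=; rewrite mem_iota add1n ltnS.
rewrite esum_fset; [|exact: finite_seq|by move=> i _; rewrite lee_fin m0].
rewrite -fsbig_seq ?iota_uniq//= sumEFin; congr (_%:E).
by rewrite big_const_seq count_predT size_iota iter_addr_0 mulr_natr.
Qed.

Lemma transition_ge0 (R : realType) (X : choiceType) (D : mtm R X)
    (s t : trace X * nat) : 0 <= transition D s t.
Proof.
rewrite /transition; case: ifP => // _; case: ifP => // /andP[/asboolP[Dt <-] _].
exact: psi_ge0.
Qed.

Lemma inflow_succ (R : realType) (X : choiceType) (D : mtm R X)
    (p : trace X * nat -> R) (T : trace X) (i : nat) :
  (forall s, states (traces D) s -> 0 <= p s) ->
  traces D T -> (0 < i < steps T)%N ->
  (\esum_(s in states (traces D)) (p s * transition D s (T, i.+1))%:E =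
   (p (T, i))%:E)%E.
Proof.
move=> p0 DT /andP[i0 iT].
have st : states (traces D) (T, i) by split=> //=; rewrite i0 ltnW.
rewrite (@esum_only _ _ _ (T, i)) => //=.
- by rewrite /transition /= iT eqxx mulr1.
- by rewrite lee_fin mulr_ge0 ?p0// transition_ge0.
(* As [i] is positive, the target index is not 1, so no jump from a last state lands here. *)
move=> [T' j] [DT' /= jT'] Tj; rewrite /transition/= eqSS (gtn_eqF i0) andbF.
case: ifP => _; last by rewrite mulr0.
rewrite xpair_eqE eqSS; case: eqP => [TT|]; last by rewrite mulr0.
by case: eqP => [ij|]; [rewrite TT ij in Tj|rewrite mulr0].
Qed.

(** Only last states of traces that end where [T] starts can jump to [(T, 1)], and each does so with
    the same probability, which factors out. *)
Lemma inflow_first (R : realType) (X : choiceType) (D : mtm R X)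
    (p : trace X * nat -> R) (T : trace X) :
  (forall s, states (traces D) s -> 0 <= p s) ->
  traces D T ->
  (\esum_(s in states (traces D)) (p s * transition D s (T, 1%N))%:E =
   (psi D (tstart T) T)%:E *
   \esum_(T' in traces D `&` [set T' | tend T' = tstart T])
      (p (T', steps T'))%:E)%E.
Proof.
move=> p0 DT.
have pS T' : traces D T' -> 0 <= p (T', steps T').
  by move=> DT'; apply: p0; split=> //=; rewrite steps_gt0 /=.
rewrite esum_statesE; last by move=> s /p0 ?; rewrite mulr_ge0 ?transition_ge0.
rewrite -esumZl ?psi_ge0//; last by move=> T' [/pS]; rewrite lee_fin.
rewrite esum_mkcondr; apply: eq_esum => T' DT'.
rewrite (@esum_only _ _ _ (steps T')) => /=.
- rewrite /transition /= ltnn andbT.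
  have [e|e] := eqVneq (tend T') (tstart T).
    by rewrite asboolT// mem_set// e -EFinM mulrC.
  move/eqP: e => e; rewrite memNset// asboolF ?mulr0//.
  by case=> _ /esym.
- by rewrite steps_gt0 /=.
- by rewrite lee_fin mulr_ge0 ?pS ?transition_ge0.
move=> i /andP[i0 iT'] ni; rewrite /transition/=.
have -> : (i < (tlen T').-1)%N by rewrite ltn_neqAle; apply/andP; split=> //; apply/eqP.
by rewrite xpair_eqE eqSS (ltn_eqF i0) andbF mulr0.
Qed.

(** * The induced chain on starting points *)

Definition point_kernel (R : realType) (X : choiceType) (D : mtm R X)
    (u v : X) : R :=
  fine (\esum_(T in between (traces D) u v) (psi D u T)%:E)%E.

Definition mean_steps (R : realType) (X : choiceType) (D : mtm R X)
    (u : X) : R :=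
  fine (\esum_(T in out (traces D) u) (psi D u T * (steps T)%:R)%:E)%E.

(** The factor [q] is constant on traces with a common start. In the uses, [I] is all traces or
    those with a given end, and [f] is the step count or 1. *)
Lemma esum_by_start (R : realType) (X : choiceType) (D : mtm R X) (s : seq X)
    (I : set (trace X)) (q : X -> R) (f : trace X -> R) :
  uniq s -> starts (traces D) = [set` s] ->
  I `<=` traces D -> (forall u, u \in s -> 0 <= q u) -> (forall T, 0 <= f T) ->
  (\esum_(T in I) (q (tstart T) * psi D (tstart T) T * f T)%:E =
   \sum_(u <- s) (q u)%:E *
     \esum_(T in I `&` [set T | tstart T = u]) (psi D u T * f T)%:E)%E.
Proof.
move=> us sE ID q0 f0.
have Is T : I T -> tstart T \in s.
  by move=> /ID DT; have : starts (traces D) (tstart T) by [exists T]; rewrite sE.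
rewrite (esum_fibers us Is); last first.
  by move=> T IT; rewrite lee_fin !mulr_ge0 ?psi_ge0 ?q0 ?Is//; exact: ID.
rewrite big_seq [RHS]big_seq; apply: eq_bigr => u su.
rewrite -esumZl ?q0//; last first.
  by move=> T [/ID DT <-]; rewrite lee_fin mulr_ge0 ?psi_ge0.
by apply: eq_esum => T [_ <-]; rewrite -EFinM mulrA.
Qed.

Lemma psi_sum (R : realType) (X : choiceType) (D : mtm R X) (u : X) :
  starts (traces D) u -> (\esum_(T in out (traces D) u) (psi D u T)%:E = 1)%E.
Proof. by move/psi_distribution => []. Qed.

(** The sum is at most the total mass 1 of [psi D u], so [fine] loses nothing. *)
Lemma point_kernelE (R : realType) (X : choiceType) (D : mtm R X) (u v : X) :
  starts (traces D) u ->
  ((point_kernel D u v)%:E =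
   \esum_(T in between (traces D) u v) (psi D u T)%:E)%E.
Proof.
move=> su; rewrite fineK// ge0_fin_numE; last first.
  by apply: esum_ge0 => T [DT <- _]; rewrite lee_fin psi_ge0.
apply: (@le_lt_trans _ _ 1%E); last exact: ltry.
rewrite -(psi_sum su) esum_mkcond [leRHS]esum_mkcond.
apply: le_esum => T _; case: ifPn => [/set_mem[DT uT _]|_].
  by rewrite mem_set.
by case: ifPn => // /set_mem[DT <-]; rewrite lee_fin psi_ge0.
Qed.

Lemma point_kernel_ge0 (R : realType) (X : choiceType) (D : mtm R X) (u v : X) :
  0 <= point_kernel D u v.
Proof.
by apply: fine_ge0; apply: esum_ge0 => T [DT <- _]; rewrite lee_fin psi_ge0.
Qed.

(** Endlessness puts the end of every trace in [s], so grouping the traces from [u] by their end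
    loses no mass. *)
Lemma point_kernel_stochastic (R : realType) (X : choiceType) (D : mtm R X)
    (s : seq X) :
  uniq s -> starts (traces D) = [set` s] -> stochastic s (point_kernel D).
Proof.
move=> us sE; split=> [u v _ _|u su]; first exact: point_kernel_ge0.
have Du : starts (traces D) u by rewrite sE.
apply: EFin_inj; rewrite -sumEFin -(psi_sum Du).
rewrite (@esum_fibers _ _ _ _ (@tend X) s)//.
- apply: eq_bigr => v _; rewrite point_kernelE//; congr esum.
  by apply/seteqP; split=> T [] => [? ? ?|[]].
- move=> T [/traces_endless[T' DT' eT'] _].
  have : starts (traces D) (tend T) by exists T'; split.
  by rewrite sE.
- by move=> T [DT <-]; rewrite lee_fin psi_ge0.
Qed.

(** A connecting path carries membership in the closed set [B] from [u] to [v]; the case of equal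
    points, not covered by strong connectedness, is immediate. *)
Lemma point_kernel_irreducible (R : realType) (X : choiceType) (D : mtm R X)
    (s : seq X) :
  starts (traces D) = [set` s] -> strongly_connected D ->
  irreducible_chain s (point_kernel D).
Proof.
move=> sE scD B Bcl u v us vs Bu.
have [<-//|/eqP uv] := eqVneq u v.
have [||//|k [z [z0 zk zs zK]]] := scD u v; rewrite ?sE//.
have zin i : (i <= k)%N -> z i \in s by move=> /zs; rewrite sE.
rewrite -zk; have : (k <= k)%N by [].
elim: {-2}k => [|i IH] ik; first by rewrite z0.
apply: (Bcl (z i)); rewrite ?zin//; [exact: ltnW|exact/IH/ltnW|].
by rewrite -lte_fin point_kernelE ?zK//; apply: zs; exact: ltnW.
Qed.

Lemma mean_stepsE (R : realType) (X : choiceType) (D : mtm R X) (u : X) :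
  finite_mean_length D -> starts (traces D) u ->
  ((mean_steps D u)%:E =
   \esum_(T in out (traces D) u) (psi D u T * (steps T)%:R)%:E)%E.
Proof.
move=> fD su; rewrite fineK// ge0_fin_numE; last first.
  by apply: esum_ge0 => T [DT <-]; rewrite lee_fin mulr_ge0 ?psi_ge0.
apply: le_lt_trans (fD u su); apply: le_esum => T [DT <-].
by rewrite lee_fin ler_wpM2l ?psi_ge0// ler_nat leq_pred.
Qed.

(** Every trace has at least one step, so the mean is at least the total mass 1. *)
Lemma mean_steps_gt0 (R : realType) (X : choiceType) (D : mtm R X) (u : X) :
  finite_mean_length D -> starts (traces D) u -> 0 < mean_steps D u.
Proof.
move=> fD su; rewrite -lte_fin mean_stepsE//.
apply: (@lt_le_trans _ _ 1%E); first exact: lte01.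
rewrite -(psi_sum su); apply: le_esum => T [DT <-].
by rewrite lee_fin ler_peMr ?psi_ge0// ler1n steps_gt0.
Qed.

(** This links stationarity to invariance: the mass arriving at [v] becomes an entry of the vector
    [q] times the kernel. *)
Lemma esum_by_end (R : realType) (X : choiceType) (D : mtm R X) (s : seq X)
    (q : X -> R) (v : X) :
  uniq s -> starts (traces D) = [set` s] -> (forall u, u \in s -> 0 <= q u) ->
  (\esum_(T in traces D `&` [set T | tend T = v])
      (q (tstart T) * psi D (tstart T) T)%:E =
   (\sum_(u <- s) q u * point_kernel D u v)%:E)%E.
Proof.
move=> us sE q0; under eq_esum do rewrite -[_ * _]mulr1.
rewrite (@esum_by_start _ _ _ s)//.
rewrite -sumEFin big_seq [RHS]big_seq; apply: eq_bigr => u su.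
rewrite EFinM point_kernelE ?sE//; congr (_ * _)%E.
under eq_esum do rewrite mulr1; congr esum.
by apply/seteqP; split=> T [] => [[]|].
Qed.

Lemma esum_steps (R : realType) (X : choiceType) (D : mtm R X) (s : seq X)
    (q : X -> R) :
  finite_mean_length D ->
  uniq s -> starts (traces D) = [set` s] -> (forall u, u \in s -> 0 <= q u) ->
  (\esum_(T in traces D)
      (q (tstart T) * psi D (tstart T) T * (steps T)%:R)%:E =
   (\sum_(u <- s) q u * mean_steps D u)%:E)%E.
Proof.
move=> fD us sE q0; rewrite (@esum_by_start _ _ _ s)//.
rewrite -sumEFin big_seq [RHS]big_seq; apply: eq_bigr => u su.
by rewrite EFinM mean_stepsE// sE.
Qed.

(** * Stationary distributions as laws of invariant vectors *)

Definition trace_law (R : realType) (X : choiceType) (D : mtm R X)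
    (q : X -> R) (x : trace X * nat) : R :=
  if `[< states (traces D) x >] then q (tstart x.1) * psi D (tstart x.1) x.1
  else 0.

Lemma trace_law_stationary (R : realType) (X : choiceType) (D : mtm R X)
    (s : seq X) (q : X -> R) :
  finite_mean_length D -> uniq s -> starts (traces D) = [set` s] ->
  (forall u, u \in s -> 0 <= q u) -> invariant_for s (point_kernel D) q ->
  \sum_(u <- s) q u * mean_steps D u = 1 ->
  stationary D (trace_law D q).
Proof.
move=> fD us sE q0 qK qL.
have Ds T : traces D T -> tstart T \in s.
  by move=> DT; have : starts (traces D) (tstart T) by [exists T]; rewrite sE.
have m0 T : traces D T -> 0 <= q (tstart T) * psi D (tstart T) T.
  by move=> DT; rewrite mulr_ge0 ?psi_ge0 ?q0 ?Ds.
have lawE x : states (traces D) x ->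
    trace_law D q x = q (tstart x.1) * psi D (tstart x.1) x.1.
  by move=> Dx; rewrite /trace_law asboolT.
have law0 x : states (traces D) x -> 0 <= trace_law D q x.
  by move=> Dx; rewrite lawE//; apply: m0; case: Dx.
split; [split=> //|].
- by move=> x Dx; rewrite /trace_law asboolF.
- under eq_esum => x Dx do rewrite lawE//.
  rewrite (esum_states_trace m0).
  by rewrite (esum_steps fD us sE q0) qL.
(* Index 0 is no state, index 1 is fed by jumps, and any larger index by its predecessor on the
   trace. *)
move=> [T [|[|i]]] /= DTi; have [DT //= iT] := DTi; rewrite /= in DT.
  rewrite inflow_first// lawE//=.
  rewrite (eq_esum (b := fun T => (q (tstart T) * psi D (tstart T) T)%:E)).
    by rewrite (esum_by_end _ us sE q0) qK ?Ds// -EFinM mulrC.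
  by move=> T' [DT' _]; rewrite lawE//; split=> //=; rewrite steps_gt0 /=.
rewrite inflow_succ// !lawE//; split=> //=; exact: ltnW.
Qed.

Lemma stationary_trace_law (R : realType) (X : choiceType) (D : mtm R X)
    (s : seq X) (p : trace X * nat -> R) :
  finite_mean_length D -> uniq s -> starts (traces D) = [set` s] ->
  stationary D p ->
  exists q : X -> R, [/\ invariant_for s (point_kernel D) q,
    \sum_(u <- s) q u * mean_steps D u = 1 & p = trace_law D q].
Proof.
move=> fD us sE [[p0 pN p1] pP].
have st T : traces D T -> states (traces D) (T, steps T).
  by move=> DT; split=> //=; rewrite steps_gt0 /=.
have cst T i : states (traces D) (T, i.+1) -> p (T, i.+1) = p (T, 1%N).
  move=> [/= DT]; elim: i => // i IH iT.
  apply: EFin_inj; rewrite -IH ?(ltnW iT)// -pP; last by split.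
  by rewrite inflow_succ.
have lastE T : traces D T -> p (T, steps T) = p (T, 1%N).
  by move=> DT; have := st T DT; case: (steps T) (steps_gt0 T) => // n _ /cst.
have first0 T : traces D T -> 0 <= p (T, 1%N).
  by move=> DT; rewrite -lastE// p0//; exact: st.
have sum1 : (\esum_(T in traces D) (p (T, 1%N) * (steps T)%:R)%:E = 1)%E.
  rewrite -p1 -(esum_states_trace first0); apply: eq_esum => -[T [[]//|i]] Ti.
  by rewrite cst.
pose Q v := (\esum_(T in traces D `&` [set T | tend T = v])
  (p (T, steps T))%:E)%E.
(* This mass is at most the total mass 1, as every trace has at least one step, so it is finite. *)
have QE v : ((fine (Q v))%:E = Q v)%E.
  rewrite fineK// ge0_fin_numE; last first.
    by apply: esum_ge0 => T [DT _]; rewrite lee_fin p0//; exact: st.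
  apply: (@le_lt_trans _ _ 1%E); last exact: ltry.
  rewrite -sum1 /Q esum_mkcondr; apply: le_esum => T DT.
  have h : p (T, steps T) <= p (T, 1%N) * (steps T)%:R.
    by rewrite lastE// ler_peMr ?first0// ler1n steps_gt0.
  by case: ifP => _; rewrite lee_fin// (le_trans _ h)// p0//; exact: st.
pose q v := fine (Q v).
have q0 u : u \in s -> 0 <= q u.
  move=> _; apply/fine_ge0/esum_ge0 => T [DT _].
  by rewrite lee_fin p0//; exact: st.
have firstE T : traces D T -> p (T, 1%N) = q (tstart T) * psi D (tstart T) T.
  move=> DT; apply: EFin_inj; rewrite -pP; last first.
    by split=> //=; exact: steps_gt0.
  by rewrite inflow_first// -/(Q _) -QE -EFinM mulrC.
exists q; split.
- move=> v vs; apply: EFin_inj.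
  rewrite -(esum_by_end _ us sE q0) QE; apply: eq_esum => T [DT _].
  by rewrite lastE// firstE.
- apply: EFin_inj; rewrite -(esum_steps fD us sE q0) -sum1.
  by apply: eq_esum => T DT; rewrite firstE.
apply/funext => x; rewrite /trace_law; case: asboolP => [|/pN//].
by case: x => T [[]//|i] Ti; rewrite cst// firstE//; case: Ti.
Qed.

(** * Existence and uniqueness of the stationary distribution *)

Theorem theorem4 (R : realType) (X : choiceType) (D : mtm R X)
    (traces_nonempty : (traces D !=set0)%classic)
    (mean_finite : finite_mean_length D)
    (D_strongly_connected : strongly_connected D) :
  exists! p : trace X * nat -> R, stationary D p.
Proof.
have /finite_seqP[s' sE'] := starts_finite D.
pose s := undup s'; have us : uniq s by exact: undup_uniq.
have sE : starts (traces D) = [set` s].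
  by rewrite sE'; apply/seteqP; split=> u /=; rewrite mem_undup.
have KS := point_kernel_stochastic us sE.
have L0 u : u \in s -> 0 < mean_steps D u.
  by move=> su; apply: mean_steps_gt0 => //; rewrite sE.
(* With no trace there would be no state to carry mass 1. *)
have s0 : (0 < size s)%N.
  have [T DT] := traces_nonempty.
  have : starts (traces D) (tstart T) by exists T.
  by rewrite sE /=; case: (s).
have [q [q0 qK [u su qu]]] := invariant_for_exists us s0 KS.
(* By [esum_steps], [c] is the total mass that [q] would give to the states; dividing by it
   normalises the law. *)
pose c := \sum_(u <- s) q u * mean_steps D u.
have c0 : 0 < c.
  rewrite /c (perm_big _ (perm_to_rem su)) big_cons/= ltr_wpDr//.
    rewrite big_seq; apply: sumr_ge0 => x /mem_rem xs.
    by rewrite mulr_ge0// ltW// L0.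
  by rewrite mulr_gt0 ?L0// lt0r qu q0.
pose q1 v := c^-1 * q v.
have q1K : invariant_for s (point_kernel D) q1.
  move=> v vs; rewrite /q1 -(qK v vs) mulr_sumr.
  by under eq_bigr do rewrite -mulrA.
have q1L : \sum_(u <- s) q1 u * mean_steps D u = 1.
  rewrite /q1; under eq_bigr do rewrite -mulrA.
  by rewrite -mulr_sumr mulVf ?gt_eqF.
exists (trace_law D q1); split.
  apply: (trace_law_stationary mean_finite us sE) => //.
  by move=> v _; rewrite mulr_ge0// invr_ge0 ltW.
move=> p /(stationary_trace_law mean_finite us sE)[q2 [q2K q2L ->]].
have irr := point_kernel_irreducible sE D_strongly_connected.
have q12 := invariant_for_unique KS irr L0 q1K q2K (etrans q1L (esym q2L)).
apply/funext => x; rewrite /trace_law; case: asboolP => // -[Dx _].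
(* The law reads its vector only at starts of traces, so agreement on [s] suffices. *)
rewrite q12//; have : starts (traces D) (tstart x.1) by exists x.1.
by rewrite sE.
Qed.
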